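(* Let $T\in\mathbb{B}_A(\mathcal{H})$. Then $$\frac{1}{4}\|T^{\sharp_A} T+TT^{\sharp_A}\|_A\leq\frac{1}{4}\left(2\omega_A^2(T)+\sqrt{\left(\|\Re_A(T)\|_A^2-\|\Im_A(T)\|_A^2\right)^2+4\|\Re_A(T)\Im_A(T)\|_A^2}\right)\leq \omega_A^2(T).$$
   Context: $\mathcal{H}$ is a complex Hilbert space with inner product $\langle\cdot,\cdot\rangle$, $\mathbb{B}(\mathcal{H})$ is the algebra of bounded linear operators on $\mathcal{H}$, and $A\in\mathbb{B}(\mathcal{H})$ is a fixed nonzero positive operator (i.e. $\langle Ax,x\rangle\geq 0$ for all $x$; $A$ need not be injective or have closed range). Put $\langle x,y\rangle_A=\langle Ax,y\rangle$ and $\|x\|_A=\sqrt{\langle x,x\rangle_A}$. $\mathcal{R}(X)$ denotes the range of $X$, and $T^*$ the usual adjoint. $\mathbb{B}_A(\mathcal{H})=\{T\in\mathbb{B}(\mathcal{H}):\mathcal{R}(T^*A)\subseteq\mathcal{R}(A)\}$ is the set of operators $T$ admitting an $A$-adjoint, i.e. some $S\in\mathbb{B}(\mathcal{H})$ with $AS=T^*A$. For $T\in\mathbb{B}_A(\mathcal{H})$, $T^{\sharp_A}\in\mathbb{B}(\mathcal{H})$ denotes the distinguished $A$-adjoint, the reduced (Douglas) solution of $AX=T^*A$, i.e. the unique solution with $\mathcal{R}(T^{\sharp_A})\subseteq\overline{\mathcal{R}(A)}$. For $X\in\mathbb{B}_A(\mathcal{H})$, $\Re_A(X)=\frac{X+X^{\sharp_A}}{2}$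 and $\Im_A(X)=\frac{X-X^{\sharp_A}}{2i}$. The $A$-seminorm is $\|T\|_A=\sup\{\|Tx\|_A: x\in\overline{\mathcal{R}(A)},\ \|x\|_A=1\}$; for $T\in\mathbb{B}_A(\mathcal{H})$ it is finite and equals $\sup\{\|Tx\|_A: x\in\mathcal{H},\ \|x\|_A=1\}$. The $A$-numerical radius is $\omega_A(T)=\sup\{|\langle Tx,x\rangle_A|: x\in\mathcal{H},\ \|x\|_A=1\}$; $\omega_A^2(T)$ means $(\omega_A(T))^2$. *)

(* Defs.v *)
From HB Require Import structures.
From mathcomp Require Import all_boot all_order all_algebra.
From mathcomp Require Import complex.
From mathcomp Require Import all_classical all_reals all_analysis.

Set Implicit Arguments.
Unset Strict Implicit.
Unset Printing Implicit Defensive.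

Import Order.TTheory GRing.Theory Num.Theory.
Import numFieldNormedType.Exports.

Local Open Scope classical_set_scope.
Local Open Scope ring_scope.
Local Open Scope complex_scope.

Section ASemiHilbert.

(* The inner product is linear in its first argument and conjugate-linear in
   the second. Operators are plain functions [H -> H] subject to
   [bounded_op]; their sums and scalar multiples are the pointwise ones. *)
Context (R : realType) (H : completeNormedModType R[i])
  (dot : {dot H for Num.conj}).
Implicit Types (A S T X : H -> H) (x y : H).

Definition dot_induces_norm : Prop := forall x, `|x| ^+ 2 = dot x x.

Definition bounded_op T : Prop :=
  linear T /\ exists M : R, forall x, `|T x| <= M%:C * `|x|.

(* In [R[i]], [0 <= z] means that [z] is real and nonnegative. *)
Definition positive_op A : Prop := forall x, 0 <= dot (A x) x.

Definition adjoint T : H -> H :=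
  xget 0 [set S | bounded_op S /\ forall x y, dot (T x) y = dot x (S y)].

Definition dotA A x y : R[i] := dot (A x) y.

(* For positive [A], [dotA A x x] is real, so nothing is lost by taking the real part. *)
Definition normA A x : R := Num.sqrt (complex.Re (dotA A x x)).

Definition in_BA A T : Prop :=
  bounded_op T /\ range (adjoint T \o A) `<=` range A.

(* The reduced (Douglas) solution X of A X = T^* A. *)
Definition sharpA A T : H -> H :=
  xget 0 [set X | [/\ bounded_op X, A \o X = adjoint T \o A
                    & range X `<=` closure (range A)]].

Definition ReA A X : H -> H := 2^-1 *: (X + sharpA A X).

Definition ImA A X : H -> H := (2 * 'i)^-1 *: (X - sharpA A X).

(* [sup] is the supremum in [R]; the sets below are bounded above when the
   operator is in [in_BA A]. *)
Definition opnormA A T : R :=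
  sup [set normA A (T x) | x in [set x | closure (range A) x /\ normA A x = 1]].

Definition numradA A T : R :=
  sup [set complex.Re `|dotA A (T x) x| | x in [set x | normA A x = 1]].

End ASemiHilbert.

(* Main.v *)
Require Import Defs.
From HB Require Import structures.
From mathcomp Require Import all_boot all_order all_algebra.
From mathcomp Require Import complex ring lra.
From mathcomp Require Import all_classical all_reals all_analysis.

Import Order.TTheory GRing.Theory Num.Theory.
Import numFieldNormedType.Exports.
Local Open Scope classical_set_scope.
Local Open Scope ring_scope.
Local Open Scope complex_scope.

Set Implicit Arguments.
Unset Strict Implicit.
Unset Printing Implicit Defensive.

(** The form [x, y |-> Re <A x, y>] is real, symmetric and positive
    semidefinite, and every quantity in the statement is a seminorm or a supremum
    taken with respect to it. Write [P] and [Q] for the A-real and A-imaginary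
    parts of [T], so that [T = P + i Q], [T^sharp = P - i Q] and
    [T^sharp T + T T^sharp = 2 (P P + Q Q)]; both [P] and [Q] are symmetric for
    the form. Let [p], [q], [r] be the A-norms of [P], [Q] and [P Q].

    First inequality. With [S = P P + Q Q], [u = P x] and [v = Q x], expanding
    [|S x|^2 = |P u + Q v|^2] bounds it by [p^2 |u|^2 + q^2 |v|^2 + 2 r |u| |v|],
    hence by [l (|u|^2 + |v|^2)], where [l] is the larger eigenvalue of the matrix
    with rows [(p^2, r)] and [(r, q^2)]. Since [|u|^2 + |v|^2 = <S x, x>] is at
    most [|S x| |x|], this gives [|S x| <= l |x|] (semi_sum_squares). As
    [2 l = p^2 + q^2 + sqrt ((p^2 - q^2)^2 + 4 r^2)], it remains to know that [p]
    and [q] are at most the A-numerical radius [w].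

    That holds because [<P x, x>] and [<Q x, x>] are the real and imaginary parts
    of [<T x, x>], and a symmetric operator is bounded by the bound of its
    quadratic form (semi_numrad, by polarisation). The second inequality then
    follows from [r <= p q], which turns the radicand into at most
    [(p^2 + q^2)^2 <= (2 w^2)^2].

    Three facts about the setting support this computation. The A-adjoint must
    exist: this is Douglas' theorem (reduced_solution), which rests on the Riesz
    representation on closed subspaces (riesz) and on a uniform boundedness
    principle (lsc_seminorm_bounded). The suprema must be finite: an operator
    which is bounded in norm and symmetric for the form is bounded for the
    A-seminorm, by Krein's argument on the growth of its orbits (orbit_growth). And
    the A-operator norm, a supremum over the closure of the range of [A] only,
    must control all vectors: the orthogonal complement of that closure is
    the kernel of [A], on which the A-seminorm vanishes (opnormA_bound). *)

(** * Real and complex numbers *)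

Section Numbers.
Context (R : realType).
Implicit Types (a : R[i]) (c e : R).

(** If [a > M], then [(a / M) ^ n] outgrows any constant, at least linearly in
    [n] by Bernoulli's inequality; [bern] is that inequality with the
    denominators cleared. *)
Lemma le_of_geometric_bound (a M K : R) : 0 <= a -> 0 <= M ->
  (forall n, a ^+ n <= K * M ^+ n) -> a <= M.
Proof.
move=> a0 M0 H; rewrite leNgt; apply/negP => Ma.
have aM : 0 < a - M by rewrite subr_gt0.
have bern n : M ^+ n * (a + n%:R * (a - M)) <= a ^+ n.+1.
  elim: n => [|n IH]; first by rewrite !expr0 mul1r mul0r addr0 expr1.
  have Mn : 0 <= M ^+ n by exact: exprn_ge0.
  rewrite exprS -natr1 (exprS a n.+1).
  apply: le_trans (ler_wpM2l a0 IH); rewrite -subr_ge0.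
  have -> : a * (M ^+ n * (a + n%:R * (a - M))) - M * M ^+ n * (a + (n%:R + 1) * (a - M))
    = M ^+ n * ((a - M) * (a - M) * (n%:R + 1)) by ring.
  by rewrite !mulr_ge0 // ?ltW // addr_ge0.
have [M00|MN0] := eqVneq M 0.
  by have := H 1%N; rewrite expr1 M00 mulr0; lra.
have Mgt0 : 0 < M by rewrite lt_neqAle eq_sym MN0.
have Hn n : a + n%:R * (a - M) <= K * M.
  have := le_trans (bern n) (H n.+1).
  by rewrite exprSr mulrA (mulrC K) -mulrA ler_pM2l // exprn_gt0.
have := Hn (Num.truncn (K * M / (a - M))).+1.
have := truncnS_gt (K * M / (a - M)); rewrite ltr_pdivrMr //; lra.
Qed.

(** The factor on the right is the larger eigenvalue of the symmetric matrix with
    diagonal [(a, d)] and off-diagonal entry [r]. After the common part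
    [(a + d) / 2] is removed, the claim is the Cauchy-Schwarz inequality in the
    plane for [(a - d, 2 r)] and [(X^2 - Y^2, 2 X Y)]. *)
Lemma quadratic_form_eigenvalue (a d r X Y : R) :
  a * X ^+ 2 + d * Y ^+ 2 + 2 * r * (X * Y)
   <= 2^-1 * (a + d + Num.sqrt ((a - d) ^+ 2 + 4 * r ^+ 2)) * (X ^+ 2 + Y ^+ 2).
Proof.
set e := Num.sqrt _.
have e0 : 0 <= e by exact: sqrtr_ge0.
have e2 : e ^+ 2 = (a - d) ^+ 2 + 4 * r ^+ 2.
  have := sqr_ge0 (a - d); have := sqr_ge0 r => r2 d2.
  by rewrite sqr_sqrtr //; lra.
suff h : (a - d) * (X ^+ 2 - Y ^+ 2) + 4 * r * (X * Y) <= e * (X ^+ 2 + Y ^+ 2) by lra.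
apply: le_trans (ler_norm _) _.
rewrite -(@ler_pXn2r _ 2%N) ?nnegrE // ?mulr_ge0 ?addr_ge0 ?sqr_ge0 //.
rewrite real_normK ?num_real // exprMn e2 -subr_ge0.
have -> : ((a - d) ^+ 2 + 4 * r ^+ 2) * (X ^+ 2 + Y ^+ 2) ^+ 2 -
  ((a - d) * (X ^+ 2 - Y ^+ 2) + 4 * r * (X * Y)) ^+ 2
  = ((a - d) * (2 * (X * Y)) - 2 * r * (X ^+ 2 - Y ^+ 2)) ^+ 2 by ring.
exact: sqr_ge0.
Qed.

Lemma eventually_invS_lt e : 0 < e -> exists N, forall n, (N <= n)%N -> n.+1%:R^-1 < e.
Proof.
move=> e0; exists (Num.truncn e^-1) => n Nn.
rewrite -[ltRHS]invrK ltf_pV2 ?posrE ?invr_gt0 //.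
by rewrite (lt_le_trans (truncnS_gt _)) // ler_nat.
Qed.

Lemma sup_ge0 (E : set R) : (forall e, E e -> 0 <= e) -> 0 <= sup E.
Proof.
move=> E0; have [[[e Ee] ubE]|/sup_out -> //] := pselect (has_sup E).
by apply: le_trans (E0 e Ee) _; apply: ub_le_sup.
Qed.

Lemma complexRe_conj (a : R[i]) : complex.Re (Num.conj a) = complex.Re a.
Proof.
by have := Re_conj a; rewrite -!complexRe => /complexI.
Qed.

Lemma ReM_real (c : R) (a : R[i]) : complex.Re (c%:C * a) = c * complex.Re a.
Proof. by case: a => a b /=; rewrite mul0r subr0. Qed.

Lemma gt0_complex (e : R[i]) : 0 < e -> exists2 d : R, 0 < d & e = d%:C.
Proof.
move=> e0; exists (complex.Re e); first by move: e0; rewrite ltcE => /andP[].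
by rewrite RRe_real // gtr0_real.
Qed.

Lemma Re_norm_ge (a : R[i]) : `|complex.Re a| <= complex.Re `|a|.
Proof. by rewrite normc_def /= -sqrtr_sqr ler_wsqrtr // lerDl sqr_ge0. Qed.

Lemma Im_norm_ge (a : R[i]) : `|complex.Im a| <= complex.Re `|a|.
Proof. by rewrite normc_def /= -sqrtr_sqr ler_wsqrtr // lerDr sqr_ge0. Qed.

Lemma Re_norm_le (a : R[i]) :
  complex.Re `|a| <= `|complex.Re a| + `|complex.Im a|.
Proof.
rewrite normc_def /= -[leRHS]ger0_norm ?addr_ge0 // -sqrtr_sqr ler_wsqrtr //.
rewrite sqrrD !real_normK ?num_real //.
have : 0 <= `|complex.Re a| * `|complex.Im a| by rewrite mulr_ge0.
lra.
Qed.

End Numbers.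

(** * Positive semidefinite forms and their symmetric operators *)

Section PsdForm.
Context (R : realType) (V : lmodType R[i]).
Implicit Types (x y z : V) (c : R).

(** Only real scalars are used, so that the real part of a sesquilinear form on a
    complex space is covered. The form may be degenerate. *)
Record psd_form (B : V -> V -> R) : Prop := PsdForm {
  psdC : forall x y, B x y = B y x;
  psdDl : forall x y z, B (x + y) z = B x z + B y z;
  psdZl : forall c x y, B (c%:C *: x) y = c * B x y;
  psd_ge0 : forall x, 0 <= B x x }.

Definition semi (B : V -> V -> R) x : R := Num.sqrt (B x x).

Definition real_linear (P : V -> V) : Prop :=
  (forall x y, P (x + y) = P x + P y) /\ (forall c x, P (c%:C *: x) = c%:C *: P x).

Context (B : V -> V -> R) (psdB : psd_form B).
Local Notation s := (semi B).

Lemma psdDr x y z : B x (y + z) = B x y + B x z.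
Proof. by rewrite psdC // psdDl // !(psdC psdB x). Qed.

Lemma psdZr c x y : B x (c%:C *: y) = c * B x y.
Proof. by rewrite psdC // psdZl // (psdC psdB x). Qed.

Lemma psdNl x y : B (- x) y = - B x y.
Proof. by rewrite -scaleN1r -(rmorphN1 (real_complex R)) psdZl // mulN1r. Qed.

Lemma psdNr x y : B x (- y) = - B x y.
Proof. by rewrite psdC // psdNl (psdC psdB x). Qed.

Lemma semi_ge0 x : 0 <= s x. Proof. exact: sqrtr_ge0. Qed.

Lemma semi_sqr x : s x ^+ 2 = B x x.
Proof. by rewrite sqr_sqrtr // psd_ge0. Qed.

Lemma semiZ c x : s (c%:C *: x) = `|c| * s x.
Proof.
by rewrite /semi psdZl // psdZr mulrA -expr2 sqrtrM ?sqr_ge0 // sqrtr_sqr.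
Qed.

Lemma semiN x : s (- x) = s x.
Proof. by rewrite /semi psdNl psdNr opprK. Qed.

Lemma psd_line x y c : B (x + c%:C *: y) (x + c%:C *: y)
  = B x x + 2 * c * B x y + c ^+ 2 * B y y.
Proof.
rewrite psdDl // !psdDr !psdZl // !psdZr (psdC psdB y x); ring.
Qed.

(** The discriminant argument; when [B y y = 0] the quadratic
    polynomial [B (x + t y) (x + t y)] is affine in [t], and stays nonnegative only
    if its slope vanishes. *)
Lemma psd_CS x y : B x y <= s x * s y.
Proof.
have [yy0|yyN0] := eqVneq (B y y) 0.
  have -> : B x y = 0.
    apply/eqP/negPn/negP => xyN0.
    (* at this parameter the affine function takes the value -1 *)
    have := psd_ge0 psdB (x + (- (B x x + 1) / (2 * B x y))%:C *: y).
    rewrite psd_line yy0 mulr0 addr0.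
    have -> : 2 * (- (B x x + 1) / (2 * B x y)) * B x y = - (B x x + 1) by field.
    lra.
  by rewrite mulr_ge0 ?semi_ge0.
have yy : 0 < B y y by rewrite lt_neqAle eq_sym yyN0 psd_ge0.
apply: le_trans (ler_norm _) _; rewrite -sqrtr_sqr /semi -sqrtrM ?psd_ge0 //.
rewrite ler_wsqrtr //.
have := psd_ge0 psdB (x + (- B x y / B y y)%:C *: y); rewrite psd_line.
have -> : B x x + 2 * (- B x y / B y y) * B x y + (- B x y / B y y) ^+ 2 * B y y
  = (B x x * B y y - B x y ^+ 2) / B y y by field.
by rewrite pmulr_lge0 ?invr_gt0 // subr_ge0.
Qed.

Lemma psd_CS_norm x y : `|B x y| <= s x * s y.
Proof.
rewrite ler_norml psd_CS andbT lerNl -psdNl.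
by rewrite (le_trans (psd_CS _ _)) // semiN.
Qed.

Lemma semiD x y : s (x + y) <= s x + s y.
Proof.
rewrite -(@ler_pXn2r _ 2%N) ?nnegrE ?addr_ge0 ?semi_ge0 //.
rewrite sqrrD !semi_sqr psdDl // !psdDr (psdC psdB y x).
have := psd_CS x y; lra.
Qed.

Lemma psd_parallelogram x y :
  B (x - y) (x - y) = 2 * B x x + 2 * B y y - B (x + y) (x + y).
Proof. rewrite !psdDl // !psdDr !psdNl !psdNr (psdC psdB y x); ring. Qed.

(** Krein's argument. By symmetry and the Cauchy-Schwarz inequality the sequence
    [a n = s (P^n x)] is log-convex, so its ratios increase and
    [a n >= a 0 * (a 1 / a 0) ^ n]. A bound [a n <= K M^n] with an arbitrary [K]
    thus forces [a 1 / a 0 <= M]. This is how boundedness in one norm is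
    transferred to a weaker seminorm. *)
Lemma orbit_growth P (K M : R) x : 0 <= K -> 0 <= M ->
  (forall y z, B (P y) z = B y (P z)) ->
  (forall n, s (iter n P x) <= K * M ^+ n) -> s (P x) <= M * s x.
Proof.
move=> K0 M0 Psym gr; pose a n := s (iter n P x).
have a_ge0 n : 0 <= a n by exact: semi_ge0.
have logcvx n : a n.+1 ^+ 2 <= a n * a n.+2.
  by rewrite /a semi_sqr /= Psym psd_CS.
have step n : a n.+1 * a 1%N <= a n.+2 * a 0%N.
  elim: n => [|n IH]; first by rewrite -expr2 mulrC logcvx.
  have [a0|aN0] := eqVneq (a n.+2) 0; first by rewrite a0 mul0r mulr_ge0.
  have apos : 0 < a n.+2 by rewrite lt_neqAle eq_sym aN0 a_ge0.
  have a1pos : 0 < a n.+1.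
    rewrite lt_neqAle a_ge0 andbT eq_sym; apply/eqP => a10.
    have := logcvx n.+1; rewrite a10 mul0r leNgt exprn_gt0 //.
  rewrite -(ler_pM2l a1pos) -subr_ge0.
  have h1 := ler_wpM2r (a_ge0 0%N) (logcvx n.+1).
  have h2 := ler_wpM2l (a_ge0 n.+2) IH.
  by rewrite subr_ge0; apply: le_trans (_ : a n.+2 ^+ 2 * a 0%N <= _); 
     [move: h2; rewrite expr2; lra | move: h1; lra].
have [s0|sN0] := eqVneq (a 0%N) 0.
  have : a 1%N ^+ 2 <= 0 by rewrite (le_trans (logcvx 0%N)) // s0 mul0r.
  rewrite -/(a 1%N) -/(a 0%N) s0 mulr0 => h.
  by rewrite -(@ler_pXn2r _ 2%N) ?nnegrE // expr0n.
have a0pos : 0 < a 0%N by rewrite lt_neqAle eq_sym sN0 a_ge0.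
rewrite -/(a 1%N) -/(a 0%N) -ler_pdivrMr //.
apply: (le_of_geometric_bound (K := K / a 0%N)) => // [|n]; rewrite ?divr_ge0 //.
rewrite -mulrA (mulrC _ (M ^+ n)) mulrA ler_pdivlMr //.
apply: le_trans (gr n).
elim: n => [|n IH]; first by rewrite expr0 mul1r.
rewrite exprS -mulrA; apply: le_trans (ler_wpM2l _ IH) _; first by rewrite divr_ge0.
rewrite -/(a n) mulrAC ler_pdivrMr //.
case: n {IH} => [|n]; last by rewrite mulrC.
by rewrite /a mulrC.
Qed.

(** Polarisation: the difference of the quadratic form at [x + t P x] and at
    [x - t P x] is [4 t s (P x) ^ 2]. With the parallelogram identity this gives
    [pol], and the choice [t = s x / s (P x)] is optimal. *)
Lemma semi_numrad P (w : R) : real_linear P ->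
  (forall y z, B (P y) z = B y (P z)) ->
  (forall x, `|B (P x) x| <= w * B x x) -> forall x, s (P x) <= w * s x.
Proof.
move=> lP Psym Pw x.
have pol t : 2 * t * s (P x) ^+ 2 <= w * (s x ^+ 2 + t ^+ 2 * s (P x) ^+ 2).
  have := ler_norml (B (P (x + t%:C *: P x)) (x + t%:C *: P x))
    (w * B (x + t%:C *: P x) (x + t%:C *: P x)).
  have := ler_norml (B (P (x + (- t)%:C *: P x)) (x + (- t)%:C *: P x))
    (w * B (x + (- t)%:C *: P x) (x + (- t)%:C *: P x)).
  rewrite !semi_sqr !Pw !psd_line !lP.1 !lP.2 !psdDl // !psdDr !psdZl // !psdZr.
  rewrite !(Psym (P x)) !(Psym x).
  move=> /esym/andP[h1 _] /esym/andP[_ h2]; lra.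
have sP := semi_ge0 (P x); have sx := semi_ge0 x.
have [->|PN0] := eqVneq (s (P x)) 0.
  have [x0|xN0] := eqVneq (s x) 0; first by rewrite x0 mulr0.
  have xpos : 0 < s x by rewrite lt_neqAle eq_sym xN0.
  rewrite mulr_ge0 //; have := le_trans (normr_ge0 _) (Pw x).
  by rewrite -semi_sqr pmulr_lge0 // exprn_gt0.
have Ppos : 0 < s (P x) by rewrite lt_neqAle eq_sym PN0.
have [x0|xN0] := eqVneq (s x) 0.
  have w0 : 0 <= w.
    have := pol 1; rewrite x0 expr0n /= add0r expr1n !mulr1 mul1r => h.
    have h2 : 0 < w * s (P x) ^+ 2 by apply: lt_le_trans h; rewrite mulr_gt0 ?exprn_gt0.
    by move: h2; rewrite pmulr_lgt0 ?exprn_gt0 // => /ltW.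
  (* if s x = 0, a small t contradicts pol: any t < 2 / w would do *)
  have := pol (w + 1)^-1; rewrite x0 expr0n /= add0r mulrA ler_pM2r ?exprn_gt0 //.
  have w1 : 0 < w + 1 by lra.
  move=> h; have := ler_wpM2r (ltW (exprn_gt0 2 w1)) h.
  have -> : 2 * (w + 1)^-1 * (w + 1) ^+ 2 = 2 * (w + 1) by field; lra.
  have -> : w * (w + 1)^-1 ^+ 2 * (w + 1) ^+ 2 = w by field; lra.
  lra.
have xpos : 0 < s x by rewrite lt_neqAle eq_sym xN0.
have := pol (s x / s (P x)).
have -> : 2 * (s x / s (P x)) * s (P x) ^+ 2 = 2 * s x * s (P x) by field.
have -> : w * (s x ^+ 2 + (s x / s (P x)) ^+ 2 * s (P x) ^+ 2) = 2 * s x * (w * s x).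
  by field.
by rewrite ler_pM2l // mulr_gt0.
Qed.

(** Kittaneh's bound for the norm of a sum of two positive operators, in the case
    of squares. Here the square roots of the summands are [P] and [Q] themselves,
    which allows a direct proof: [P P + Q Q] is [C^* C] for the column [C] with
    entries [P] and [Q], and [C C^*] is a 2 by 2 operator matrix dominated by the
    scalar matrix of the norms of its entries. *)
Lemma semi_sum_squares P Q (p q r : R) :
  (forall y z, B (P y) z = B y (P z)) ->
  (forall y z, B (Q y) z = B y (Q z)) ->
  (forall x, s (P x) <= p * s x) -> (forall x, s (Q x) <= q * s x) ->
  (forall x, s (P (Q x)) <= r * s x) ->
  forall x, s (P (P x) + Q (Q x)) <=
   2^-1 * (p ^+ 2 + q ^+ 2 + Num.sqrt ((p ^+ 2 - q ^+ 2) ^+ 2 + 4 * r ^+ 2)) * s x.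
Proof.
move=> Psym Qsym Pp Qq PQr x; set l := 2^-1 * _.
set S := _ + _; set u := P x; set v := Q x.
have l0 : 0 <= l.
  by rewrite mulr_ge0 ?invr_ge0 // !addr_ge0 ?sqr_ge0 ?sqrtr_ge0.
have BS : s S ^+ 2 <= l * (s u ^+ 2 + s v ^+ 2).
  apply: le_trans (quadratic_form_eigenvalue _ _ _ _ _); rewrite semi_sqr psdDl // !psdDr.
  rewrite (psdC psdB (Q v)) -!semi_sqr Psym.
  have h1 : s (P u) ^+ 2 <= p ^+ 2 * s u ^+ 2.
    by rewrite -exprMn ler_pXn2r ?nnegrE ?semi_ge0 // (le_trans _ (Pp u)) ?semi_ge0.
  have h2 : s (Q v) ^+ 2 <= q ^+ 2 * s v ^+ 2.
    by rewrite -exprMn ler_pXn2r ?nnegrE ?semi_ge0 // (le_trans _ (Qq v)) ?semi_ge0.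
  have h3 : B u (P (Q v)) <= r * (s u * s v).
    by apply: le_trans (psd_CS _ _) _; have := ler_wpM2l (semi_ge0 u) (PQr v); lra.
  lra.
have uv : s u ^+ 2 + s v ^+ 2 <= s S * s x.
  by rewrite !semi_sqr /u /v -(Psym _ x) -(Qsym _ x) -psdDl // psd_CS.
have sS := semi_ge0 S.
have [->|SN0] := eqVneq (s S) 0; first by rewrite mulr_ge0 ?semi_ge0.
have Spos : 0 < s S by rewrite lt_neqAle eq_sym SN0.
rewrite -(ler_pM2l Spos) -expr2; apply: le_trans BS _.
by have := ler_wpM2l l0 uv; lra.
Qed.

End PsdForm.

(** * Completeness and minimisation of a quadratic functional *)

Section Hilbert.
Context (R : realType) (H : completeNormedModType R[i])
  (dot : {dot H for Num.conj}) (dotH : dot_induces_norm dot).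
Implicit Types (x y z : H) (c e : R).

Lemma dotC x y : dot x y = Num.conj (dot y x).
Proof. by rewrite hermC expr0 mul1r. Qed.

Definition re_dot x y : R := complex.Re (dot x y).
Local Notation rdot := re_dot.
Local Notation nrm := (semi rdot).

Lemma re_dot_psd : psd_form rdot.
Proof.
split=> [x y|x y z|c x y|x].
- by rewrite /re_dot dotC complexRe_conj.
- by rewrite /re_dot linearDl /= raddfD.
- by rewrite /re_dot linearZl_LR /= ReM_real.
- by have := dnorm_ge0 dot x; rewrite lecE /= => /andP[].
Qed.

Lemma norm_nrm x : `|x| = (nrm x)%:C.
Proof.
have xr : `|x| \is Num.real by exact: normr_real.
rewrite -(RRe_real xr); congr (_%:C).
have : 0 <= complex.Re `|x| by have := normr_ge0 x; rewrite lecE => /andP[].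
move=> x0; rewrite /semi /re_dot -dotH -(RRe_real xr) -rmorphXn /= sqrtr_sqr.
by rewrite ger0_norm.
Qed.

(** Completeness restated with real radii: the balls of the space have radii in
    [R[i]], where only the real positive ones are nonempty. *)
Lemma nrm_complete (u : nat -> H) :
  (forall e, 0 < e -> exists N, forall m n, (N <= m)%N -> (N <= n)%N ->
     nrm (u m - u n) < e) ->
  exists l, forall e, 0 < e -> exists N, forall n, (N <= n)%N -> nrm (l - u n) < e.
Proof.
move=> cau.
have : cvg (u @ \oo).
  apply/cauchy_cvgP; apply: cauchy_exP => e' /gt0_complex[e e0 ->].
  have [N HN] := cau e e0; exists (u N), N => // n Nn.
  by rewrite -ball_normE /ball_ /= norm_nrm ltcR; apply: HN.
move=> cu; exists (lim (u @ \oo)) => e e0.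
have /cvgrPdist_lt/(_ e%:C) := cu; rewrite ltcR => /(_ e0)[N _ HN].
by exists N => n Nn; have := HN n Nn; rewrite /= norm_nrm ltcR.
Qed.

Lemma closure_nrm (S : set H) x :
  closure S x <-> forall e, 0 < e -> exists2 y, S y & nrm (x - y) < e.
Proof.
split=> [clS e e0|near_S V /nbhs_ballP[e' /gt0_complex[e e0 ->] eV]].
  have /clS [y [Sy]] : nbhs x (ball x e%:C).
    by apply: nbhsx_ballx; rewrite ltcR.
  by rewrite -ball_normE /ball_ /= norm_nrm ltcR => xy; exists y.
have [y Sy xy] := near_S e e0; exists y; split=> //; apply: eV.
by rewrite -ball_normE /ball_ /= norm_nrm ltcR.
Qed.

Definition real_subspace (V : set H) : Prop :=
  [/\ V 0, forall x y, V x -> V y -> V (x + y) & forall c x, V x -> V (c%:C *: x)].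

(** The representing vector is the minimiser of [J x = |x|^2 - 2 g x] on [V]. The
    parallelogram identity makes every minimising sequence Cauchy, and the
    vanishing of the first variation of [J] at the limit is the claim. *)
Lemma riesz_real (V : set H) (g : H -> R) (M : R) :
  real_subspace V -> closed V ->
  (forall x y, g (x + y) = g x + g y) -> (forall c x, g (c%:C *: x) = c * g x) ->
  (forall x, g x <= M * nrm x) ->
  exists2 z, V z & forall h, V h -> rdot z h = g h.
Proof.
move=> [V0 VD VZ] clV gD gZ gM; have psd := re_dot_psd.
pose J x := rdot x x - 2 * g x.
have Jlb x : - M ^+ 2 <= J x.
  rewrite /J -(semi_sqr psd); have := gM x; have := sqr_ge0 (nrm x - M).
  rewrite sqrrB; lra.
have hinf : has_inf [set J x | x in V].
  split; first by exists (J 0), 0.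
  by exists (- M ^+ 2) => _ [x _ <-].
set m := inf [set J x | x in V].
have Jm x : V x -> m <= J x by move=> Vx; apply: ge_inf; [exact: hinf.2|exists x].
have /choice[u uP] (n : nat) : exists x, V x /\ J x < m + n.+1%:R^-1.
  have [|_ [x Vx <-] Jx] := inf_adherent (_ : 0 < n.+1%:R^-1 :> R) hinf => //.
  by exists x.
have [z uz] : exists l, forall e, 0 < e -> exists N, forall n, (N <= n)%N -> nrm (l - u n) < e.
  apply: nrm_complete => e e0.
  have [|N HN] := eventually_invS_lt (_ : 0 < e ^+ 2 / 4); first by rewrite divr_gt0 ?exprn_gt0.
  exists N => i j Ni Nj; rewrite -(@ltr_pXn2r _ 2%N) ?nnegrE ?semi_ge0 ?ltW //.
  rewrite (semi_sqr psd) (psd_parallelogram psd).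
  have [[Vi Ji] [Vj Jj]] := (uP i, uP j).
  have := Jm ((2^-1)%:C *: (u i + u j)) (VZ _ _ (VD _ _ Vi Vj)).
  move: (HN i Ni) (HN j Nj) Ji Jj; rewrite /J (psdZl psd) (psdZr psd) gZ gD.
  move: (i.+1%:R^-1) (j.+1%:R^-1) => a b; lra.
have Vz : V z.
  rewrite ((closure_id V).1 clV); apply/closure_nrm => e e0.
  by have [N HN] := uz e e0; exists (u N); [exact: (uP N).1|exact: HN].
exists z => // h Vh.
pose d := rdot z h - g h.
(* The minimality of J at z, in the direction h. It is derived along
   the minimising sequence, so that only x |-> rdot x h is passed to the limit. *)
have quad t : 0 <= 2 * t * d + t ^+ 2 * rdot h h.
  have K0 : 0 < 1 + 2 * `|t| * nrm h.
    by rewrite ltr_pwDl // !mulr_ge0 ?semi_ge0.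
  apply/ler_addgt0Pr => e0 e0_gt0; pose e := e0 / (1 + 2 * `|t| * nrm h).
  have e_gt0 : 0 < e by rewrite divr_gt0.
  have e0E : e0 = e * (1 + 2 * `|t| * nrm h) by rewrite /e divfK ?gt_eqF.
  have [N1 HN1] := uz e e_gt0; have [N2 HN2] := eventually_invS_lt e_gt0.
  pose n := maxn N1 N2.
  have un := HN1 n (leq_maxl _ _); have en := HN2 n (leq_maxr _ _).
  have [Vn Jn] := uP n.
  have := Jm _ (VD _ _ Vn (VZ t _ Vh)).
  rewrite /J (psd_line psd) gD gZ; rewrite /J in Jn => Jt.
  have zu : `|t * rdot (z - u n) h| <= e * `|t| * nrm h.
    rewrite normrM (mulrC e) -mulrA ler_wpM2l //.
    apply: le_trans (psd_CS_norm psd _ _) _.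
    by rewrite ler_wpM2r ?semi_ge0 // ltW.
  move: zu; rewrite ler_norml (psdDl psd) (psdNl psd) => /andP[zu _].
  move: (n.+1%:R^-1) en Jn => a en Jn; rewrite /d e0E; lra.
apply/eqP; rewrite -subr_eq0 -/d; apply/eqP.
have q0 := psd_ge0 psd h; have q1 : 0 < rdot h h + 1 by lra.
(* adding 1 to the optimal denominator avoids the case h = 0 *)
have := quad (- d / (rdot h h + 1)).
have -> : 2 * (- d / (rdot h h + 1)) * d + (- d / (rdot h h + 1)) ^+ 2 * rdot h h
  = - ((rdot h h + 2) * d ^+ 2) / (rdot h h + 1) ^+ 2 by field; lra.
rewrite pmulr_lge0 ?invr_gt0 ?exprn_gt0 // oppr_ge0 pmulr_rle0; last lra.
by move=> d2; apply/eqP; rewrite -sqrf_eq0 eq_le d2 sqr_ge0.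
Qed.

End Hilbert.

(** * Uniform boundedness and the Riesz representation *)

Section Hilbert.
Context (R : realType) (H : completeNormedModType R[i])
  (dot : {dot H for Num.conj}) (dotH : dot_induces_norm dot).
Implicit Types (x y z : H) (c e : R) (A T : H -> H).
Local Notation rdot := (re_dot dot).
Local Notation nrm := (semi rdot).
Local Notation psd := (re_dot_psd dot).

Lemma nrm_eq0 x : nrm x = 0 -> x = 0.
Proof. by move=> x0; apply/normr0_eq0; rewrite (norm_nrm dotH) x0. Qed.

(** The uniform boundedness principle, for a lower semicontinuous seminorm. If [P]
    is not bounded, each ball contains a point where [P] exceeds any prescribed
    number, because [P (x + v) + P (x - v) >= 2 P v]; by lower semicontinuity it
    does so on a smaller ball. The common point of a nested sequence of such
    balls has no finite value. *)
Lemma lsc_seminorm_bounded (P : H -> R) :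
  (forall x y, P (x + y) <= P x + P y) ->
  (forall c x, P (c%:C *: x) = `|c| * P x) ->
  (forall x K, 0 <= K -> K < P x ->
     exists2 e, 0 < e & forall y, nrm (y - x) < e -> K < P y) ->
  exists M, forall x, P x <= M * nrm x.
Proof.
move=> PD PZ Plsc; apply: contrapT => /forallNP unb.
have PN x : P (- x) = P x.
  by have := PZ (-1) x; rewrite rmorphN1 scaleN1r normrN1 mul1r.
have step (n : nat) (p : H * R) : exists p' : H * R, 0 < p.2 ->
    [/\ 0 < p'.2, p'.2 <= n.+1%:R^-1,
      forall y, nrm (y - p'.1) <= p'.2 -> nrm (y - p.1) <= p.2 &
      forall y, nrm (y - p'.1) <= p'.2 -> n%:R < P y].
  have [r0|] := ltP 0 p.2; last by exists p.
  case: p r0 => x r /= r0.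
  have /existsNP[u /negP] := unb (2 * n%:R / r); rewrite -ltNge => uP.
  have u0 : 0 < nrm u.
    rewrite lt_neqAle semi_ge0 andbT eq_sym; apply/eqP => /nrm_eq0 u0.
    move: uP; rewrite u0; have := PZ 0 0; rewrite scaler0 normr0 mul0r => ->.
    have := semiZ psd 0 0; rewrite scaler0 normr0 mul0r => ->.
    by rewrite mulr0 ltxx.
  (* u rescaled to reach half of the radius *)
  pose v := (r / 2 / nrm u)%:C *: u.
  have nv : nrm v = r / 2.
    by rewrite (semiZ psd) ger0_norm ?divfK ?gt_eqF // !divr_ge0 ?ltW.
  have Pv : n%:R < P v.
    rewrite PZ ger0_norm; last by rewrite !divr_ge0 ?ltW.
    have c0 : 0 < r / 2 / nrm u by rewrite !divr_gt0.
    have := uP; rewrite -(ltr_pM2l c0); apply: le_lt_trans.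
    by rewrite le_eqVlt; apply/orP; left; apply/eqP; field; lra.
  have [x' xx' Px'] : exists2 x', nrm (x' - x) = r / 2 & n%:R < P x'.
    have [Pp|Pp] := ltP n%:R (P (x + v)).
      by exists (x + v) => //; rewrite addrC addKr.
    exists (x - v); first by rewrite addrC addKr (semiN psd).
    have := PD (x + v) (- (x - v)); rewrite PN.
    have -> : x + v - (x - v) = 2%:C *: v.
      rewrite opprB addrC addrA subrK -mulr2n -scaler_nat.
      by rewrite rmorph_nat.
    rewrite PZ ger0_norm //; lra.
  have [d d0 dP] := Plsc x' n%:R (ler0n _ _) Px'.
  pose r' := Num.min (r / 2) (Num.min (d / 2) n.+1%:R^-1).
  have r'1 : r' <= r / 2 by rewrite ge_min lexx.
  have r'2 : r' <= d / 2 by rewrite !ge_min lexx orbT.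
  exists (x', r') => _ /=; split.
  - by rewrite !lt_min !divr_gt0 // invr_gt0 ltr0n.
  - by rewrite !ge_min lexx !orbT.
  - move=> y yx'; have := semiD psd (y - x') (x' - x).
    rewrite addrA subrK xx'; lra.
  - by move=> y yx'; apply: dP; lra.
have /choice[F FP] (np : nat * (H * R)) := step np.1 np.2.
pose p := fix p n : H * R := if n is k.+1 then F (k, p k) else (0, 1).
have p_gt0 n : 0 < (p n).2.
  by elim: n => [|n IH] /=; [exact: ltr01|have [] := FP (n, p n) IH].
have nest m n y : (n <= m)%N -> nrm (y - (p m).1) <= (p m).2 ->
    nrm (y - (p n).1) <= (p n).2.
  elim: m => [|m IH]; first by rewrite leqn0 => /eqP->.
  rewrite leq_eqVlt => /orP[/eqP-> //|/IH{}IH].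
  by have [_ _ sub _] := FP (m, p m) (p_gt0 m) => /sub/IH.
have nrm0 : nrm 0 = 0 by have := semiZ psd 0 0; rewrite scaler0 normr0 mul0r.
have cen m n : (n <= m)%N -> nrm ((p m).1 - (p n).1) <= (p n).2.
  by move=> nm; apply: (nest m) => //; rewrite subrr nrm0 ltW.
have [l lP] : exists l, forall e, 0 < e ->
    exists N, forall n, (N <= n)%N -> nrm (l - (p n).1) < e.
  apply: (nrm_complete dotH) => e e0.
  have [|N HN] := eventually_invS_lt (_ : 0 < e / 2); first by rewrite divr_gt0.
  exists N.+1 => m n Nm Nn.
  have rN : (p N.+1).2 < e / 2.
    by have [_ h _ _] := FP (N, p N) (p_gt0 N); apply: le_lt_trans h (HN N _).
  have := semiD psd ((p m).1 - (p N.+1).1) (- ((p n).1 - (p N.+1).1)).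
  rewrite (semiN psd) opprB addrA subrK.
  have := cen _ _ Nm; have := cen _ _ Nn; lra.
have lball n : nrm (l - (p n).1) <= (p n).2.
  apply/ler_addgt0Pr => e /lP[N HN].
  have := HN (maxn N n) (leq_maxl _ _); have := cen _ _ (leq_maxr N n).
  have := semiD psd (l - (p (maxn N n)).1) ((p (maxn N n)).1 - (p n).1).
  rewrite addrA subrK; lra.
have : (Num.truncn (P l)).+1%:R < P l.
  have [_ _ _ h] := FP ((Num.truncn (P l)).+1, p (Num.truncn (P l)).+1) (p_gt0 _).
  exact/h/(lball (Num.truncn (P l)).+2).
by rewrite ltNge ltW // truncnS_gt.
Qed.

Definition linear_subspace (V : set H) : Prop :=
  [/\ V 0, forall x y, V x -> V y -> V (x + y) & forall (a : R[i]) x, V x -> V (a *: x)].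

Lemma subspaceB (V : set H) x y : linear_subspace V -> V x -> V y -> V (x - y).
Proof.
by move=> [_ VD VZ] Vx Vy; apply: VD => //; rewrite -scaleN1r; apply: VZ.
Qed.

(** The real representation of [Re f] suffices: applied to [i h] it gives the
    imaginary part of [f h]. *)
Lemma riesz (V : set H) (f : H -> R[i]) (M : R) :
  linear_subspace V -> closed V -> scalar f -> (forall x, complex.Re (f x) <= M * nrm x) ->
  exists2 z, V z & forall h, V h -> f h = dot h z.
Proof.
move=> [V0 VD VZ] clV lf fM.
have fD x y : f (x + y) = f x + f y by have := lf 1 x y; rewrite scale1r mul1r.
have f0 : f 0 = 0 by apply/(addrI (f 0)); rewrite -fD !addr0.
have fZ a x : f (a *: x) = a * f x by have := lf a x 0; rewrite !addr0 f0 addr0.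
have [|||||z Vz zP] := @riesz_real _ _ _ dotH V (fun x => complex.Re (f x)) M.
- by split=> // c x; apply: VZ.
- by [].
- by move=> x y; rewrite /= fD raddfD.
- by move=> c x; rewrite /= fZ ReM_real.
- exact: fM.
exists z => // h Vh; apply/eqP; rewrite eq_complex; apply/andP; split; apply/eqP.
- by have := zP h Vh; rewrite (psdC psd) /= => <-.
- have := zP _ (VZ 'i%C _ Vh); rewrite (psdC psd) /= fZ /re_dot linearZl_LR /=.
  by rewrite !(mulrC 'i%C) !ReiNIm => /oppr_inj.
Qed.

End Hilbert.

(** * Adjoints, projections and the reduced solution of A X = S *)

Section Hilbert.
Context (R : realType) (H : completeNormedModType R[i])
  (dot : {dot H for Num.conj}) (dotH : dot_induces_norm dot).
Implicit Types (x y z : H) (c e : R) (A T : H -> H).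
Local Notation rdot := (re_dot dot).
Local Notation nrm := (semi rdot).
Local Notation psd := (re_dot_psd dot).

Lemma linear_opD T x y : linear T -> T (x + y) = T x + T y.
Proof. by move=> lT; have := lT 1 x y; rewrite !scale1r. Qed.

Lemma linear_op0 T : linear T -> T 0 = 0.
Proof. by move=> lT; apply/(addrI (T 0)); rewrite -linear_opD // !addr0. Qed.

Lemma linear_opZ T (a : R[i]) x : linear T -> T (a *: x) = a *: T x.
Proof. by move=> lT; have := lT a x 0; rewrite !addr0 linear_op0 // addr0. Qed.

Lemma linear_opB T x y : linear T -> T (x - y) = T x - T y.
Proof. by move=> lT; rewrite -scaleN1r linear_opD // linear_opZ // scaleN1r. Qed.

Lemma linear_real_linear T : linear T -> real_linear T.
Proof.
by move=> lT; split=> [x y|c x]; [exact: linear_opD|exact: linear_opZ].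
Qed.

Lemma bounded_opP T :
  bounded_op T <-> linear T /\ exists2 M, 0 <= M & forall x, nrm (T x) <= M * nrm x.
Proof.
split=> -[lT [M]]; last first.
  move=> M0 TM; split=> //; exists M => x.
  by rewrite !(norm_nrm dotH) -rmorphM lecR.
move=> TM; split=> //; exists `|M| => // x.
have := TM x; rewrite !(norm_nrm dotH) -rmorphM lecR => /le_trans; apply.
by rewrite ler_wpM2r ?semi_ge0 // ler_norm.
Qed.

Lemma dot_eqr y z : (forall x, dot x y = dot x z) -> y = z.
Proof.
move=> yz; apply/eqP; rewrite -subr_eq0 -(dnorm_eq0 dot).
by rewrite linearBr /= yz subrr.
Qed.

Lemma adjoint_spec T : bounded_op T ->
  bounded_op (adjoint dot T) /\ forall x y, dot (T x) y = dot x (adjoint dot T y).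
Proof.
move=> bT; have /bounded_opP[lT [M M0 TM]] := bT.
suff: exists S, bounded_op S /\ forall x y, dot (T x) y = dot x (S y).
  exact: xgetPex.
have /choice[S ST] (y : H) : exists z, forall x, dot (T x) y = dot x z.
  have [||||z _ zP] := riesz dotH (V := setT) (f := fun x => dot (T x) y) (M := M * nrm y).
  - by split.
  - exact: closedT.
  - by move=> a u v; rewrite lT linearPl.
  - move=> x; apply: le_trans (psd_CS psd _ _) _.
    by have := ler_wpM2r (semi_ge0 rdot y) (TM x); lra.
  - by exists z => x; apply: zP.
exists S; split=> [|x y]; last exact: ST.
apply/bounded_opP; split.
  move=> a u v; apply: dot_eqr => x.
  by rewrite -ST !(linearPr dot) /= !ST.
exists M => // y.
have [->|S0] := eqVneq (nrm (S y)) 0; first by rewrite mulr_ge0 ?semi_ge0.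
have Sy : 0 < nrm (S y) by rewrite lt_neqAle eq_sym S0 semi_ge0.
rewrite -(ler_pM2l Sy) -expr2 (semi_sqr psd) /re_dot -ST.
apply: le_trans (psd_CS psd _ _) _.
by have := ler_wpM2r (semi_ge0 rdot y) (TM (S y)); lra.
Qed.

(** A positive operator on a complex space is self-adjoint: its quadratic form is
    real at [x + y] and at [x + i y], which gives the imaginary and real
    parts of the claim. *)
Lemma positive_op_sym A : linear A -> positive_op dot A ->
  forall x y, dot (A x) y = dot x (A y).
Proof.
move=> lA pA x y.
have Im0 z : complex.Im (dot (A z) z) = 0 by apply/eqP; have := pA z; rewrite lecE => /andP[].
have := Im0 (x + y); have := Im0 (x + 'i%C *: y).
rewrite !linear_opD // linear_opZ // !linearDl /= !linearDr /= !linearZl_LR /=.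
rewrite !(linearZr_LR dot) /= (dotC _ x (A y)).
move: (Im0 x) (Im0 y).
case: (dot (A x) x) => a b; case: (dot (A y) y) => a1 b1.
case: (dot (A x) y) => a2 b2; case: (dot (A y) x) => a3 b3.
have -> : Num.conj ('i%C : R[i]) = 0 -i* 1 by [].
have -> : Num.conj (a3 +i* b3) = a3 -i* b3 by [].
rewrite /= => b0 b10 h1 h2; apply/eqP; rewrite eq_complex /=.
apply/andP; split; apply/eqP; lra.
Qed.

Lemma closure_subspace (V : set H) : linear_subspace V -> linear_subspace (closure V).
Proof.
move=> [V0 VD VZ]; split; first exact: subset_closure.
  move=> x y /(closure_nrm dotH) Vx /(closure_nrm dotH) Vy.
  apply/(closure_nrm dotH) => e e0.
  have e2 : 0 < e / 2 by rewrite divr_gt0.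
  have [x' Vx' xx'] := Vx _ e2; have [y' Vy' yy'] := Vy _ e2.
  exists (x' + y'); first exact: VD.
  have := semiD psd (x - x') (y - y'); rewrite addrACA -opprD; lra.
move=> a x /(closure_nrm dotH) Vx; apply/(closure_nrm dotH) => e e0.
pose k := complex.Re `|a|; have k0 : 0 <= k by have := normr_ge0 a; rewrite lecE => /andP[].
have [|x' Vx' xx'] := Vx (e / (k + 1)); first by rewrite divr_gt0 // ltr_wpDl.
exists (a *: x'); first exact: VZ.
rewrite -scalerBr -ltcR -(norm_nrm dotH) normrZ (norm_nrm dotH).
rewrite -(RRe_real (normr_real a)) -/k -rmorphM ltcR.
have k1 : 0 < k + 1 by lra.
move: xx'; rewrite ltr_pdivlMr // => xx'.
by have := semi_ge0 rdot (x - x'); lra.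
Qed.

Lemma projection (V : set H) x : linear_subspace V -> closed V ->
  exists2 y, V y & forall h, V h -> dot h (x - y) = 0.
Proof.
move=> sV clV.
have [||y Vy yP] := riesz dotH (f := fun z => dot z x) (M := nrm x) sV clV.
- by move=> a u v; rewrite linearPl.
- by move=> z; rewrite mulrC; exact: (psd_CS psd).
by exists y => // h Vh; rewrite linearBr /= yP // subrr.
Qed.

Lemma range_subspace T : linear T -> linear_subspace (range T).
Proof.
move=> lT; split; first by exists 0; rewrite ?linear_op0.
  by move=> _ _ [x _ <-] [y _ <-]; exists (x + y); rewrite ?linear_opD.
by move=> a _ [x _ <-]; exists (a *: x); rewrite ?linear_opZ.
Qed.

Lemma orthogonal_range_ker A x : linear A -> positive_op dot A ->
  (forall h, closure (range A) h -> dot h x = 0) -> A x = 0.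
Proof.
move=> lA pA ort; apply: dot_eqr => z.
rewrite -(positive_op_sym lA pA) linear0r ort //.
by apply: subset_closure; exists z.
Qed.

Lemma ker_orthogonal_range A x h : linear A -> positive_op dot A ->
  A x = 0 -> closure (range A) h -> rdot x h = 0.
Proof.
move=> lA pA Ax0 /(closure_nrm dotH) clh; apply/eqP/negPn/negP => xh.
have xh0 : 0 < `|rdot x h| by rewrite normr_gt0.
have x1 : 0 < nrm x + 1 by rewrite ltr_wpDl ?semi_ge0.
have [|_ [z _ <-] hz] := clh (`|rdot x h| / (nrm x + 1)); first by rewrite divr_gt0.
have := psd_CS_norm psd x (h - A z); rewrite (psdDr psd) (psdNr psd).
rewrite {2}/re_dot -(positive_op_sym lA pA) Ax0 linear0l /= subr0.
move: hz; rewrite ltr_pdivlMr // => hz.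
have := semi_ge0 rdot x; have := semi_ge0 rdot (h - A z); lra.
Qed.

Lemma injective_on_range A y z : linear A -> positive_op dot A ->
  closure (range A) y -> closure (range A) z -> A y = A z -> y = z.
Proof.
move=> lA pA Vy Vz Ayz; apply/eqP; rewrite -subr_eq0; apply/eqP.
apply: (nrm_eq0 dotH); apply/eqP; rewrite -sqrf_eq0 (semi_sqr psd); apply/eqP.
apply: (@ker_orthogonal_range A) => //; first by rewrite linear_opB // Ayz subrr.
apply: (@subspaceB _ _ (closure (range A))) => //; exact/closure_subspace/range_subspace.
Qed.

(** Douglas' theorem. For each [x], project a preimage of [S x] under [A] onto
    the closure of the range of [A]; the difference lies in the kernel of [A].
    Injectivity of [A] on that closure makes the choice [X] linear.
    Boundedness comes from lsc_seminorm_bounded applied to [x |-> |X x|]: this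
    seminorm is the supremum of [x |-> <X x, A z> / |A z|], and
    [<X x, A z> = <S x, z>] is continuous in [x]. *)
Lemma reduced_solution A S : bounded_op A -> positive_op dot A ->
  bounded_op S -> range S `<=` range A ->
  exists X, [/\ bounded_op X, A \o X = S & range X `<=` closure (range A)].
Proof.
move=> /bounded_opP[lA [_ _ _]] pA /bounded_opP[lS [M M0 SM]] SA.
have sV := closure_subspace (range_subspace lA).
have /choice[X XP] x : exists y, closure (range A) y /\ A y = S x.
  have [u _ uP] := SA (S x) (imageP _ I).
  have [y Vy yP] := projection u sV (closed_closure (A := range A)).
  exists y; split=> //; apply/eqP; rewrite -uP eq_sym -subr_eq0 -linear_opB //; apply/eqP.
  exact: orthogonal_range_ker.
have AX x : A (X x) = S x by exact: (XP x).2.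
have VX x : closure (range A) (X x) by exact: (XP x).1.
have lX : linear X.
  move=> a x y; have [_ VD VZ] := sV.
  apply: (@injective_on_range A) => //; first exact/VD/VX/VZ.
  by rewrite AX lS lA !AX.
exists X; split=> [||_ [x _ <-] //]; last by apply/funext => x; exact: AX.
apply/bounded_opP; split=> //.
have [|||N NP] := lsc_seminorm_bounded dotH (P := nrm \o X).
- by move=> x y /=; rewrite linear_opD // (semiD psd).
- by move=> c x /=; rewrite linear_opZ // (semiZ psd).
- move=> x K K0 /= KX; pose n := nrm (X x).
  (* an approximation A z of X x within d has a quotient <X x, A z> / |A z| of at
     least (n^2 - n d) / (n + d), which exceeds K as soon as d (n + K) < n (n - K) *)
  pose d := n * (n - K) / (2 * (n + K)).
  have n0 : 0 < n by exact: le_lt_trans K0 KX.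
  have nK : 0 < n + K by lra.
  have KX' : 0 < n - K by rewrite subr_gt0.
  have d0 : 0 < d by rewrite divr_gt0 ?mulr_gt0.
  have dE : d * (n + K) = n * (n - K) / 2 by rewrite /d; field; lra.
  have [_ [z _ <-] Xz] := (closure_nrm dotH (range A) (X x)).1 (VX x) d d0.
  have gap : K * nrm (A z) < rdot (X x) (A z).
    have h1 : nrm (A z) <= n + d.
      have := semiD psd (X x) (- (X x - A z)); rewrite (semiN psd) opprB addrC subrK.
      rewrite -/n; lra.
    have h2 : n ^+ 2 - n * d <= rdot (X x) (A z).
      have -> : A z = X x - (X x - A z) by rewrite opprB addrC subrK.
      rewrite (psdDr psd) (psdNr psd) -(semi_sqr psd) -/n.
      have := psd_CS psd (X x) (X x - A z); rewrite -/n.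
      have := ler_wpM2l (ltW n0) (ltW Xz); lra.
    apply: lt_le_trans h2; have := ler_wpM2l K0 h1.
    have : 0 < n * (n - K) by rewrite mulr_gt0.
    lra.
  have XS y : rdot (X y) (A z) = rdot (S y) z.
    by rewrite /re_dot -(positive_op_sym lA pA) AX.
  pose g := rdot (X x) (A z) - K * nrm (A z).
  have g0 : 0 < g by rewrite subr_gt0.
  have C0 : 0 < M * nrm z + 1 by rewrite ltr_wpDl // mulr_ge0 ?semi_ge0.
  exists (g / (M * nrm z + 1)); first by rewrite divr_gt0.
  move=> y; rewrite ltr_pdivlMr // => yx; rewrite ltNge; apply/negP => XK.
  have h1 := psd_CS psd (X y) (A z).
  have h2 := ler_wpM2r (semi_ge0 rdot (A z)) XK.
  have h3 := psd_CS_norm psd (S (y - x)) z.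
  move: h3; rewrite linear_opB // (psdDl psd) (psdNl psd) -!XS ler_norml => /andP[h3 _].
  have h4 := ler_wpM2r (semi_ge0 rdot z) (SM (y - x)); rewrite linear_opB // in h4.
  have h5 := semi_ge0 rdot (y - x).
  rewrite /g in yx; lra.
exists `|N| => // x; apply: le_trans (NP x) _.
by rewrite ler_wpM2r ?semi_ge0 // ler_norm.
Qed.

Lemma sharpA_spec A T : bounded_op A -> positive_op dot A -> in_BA dot A T ->
  bounded_op (sharpA dot A T) /\ forall x, A (sharpA dot A T x) = adjoint dot T (A x).
Proof.
move=> bA pA [bT TA].
have [X XP] : exists X, [/\ bounded_op X, A \o X = adjoint dot T \o A
    & range X `<=` closure (range A)].
  apply: reduced_solution => //.
  have [/bounded_opP[lS [M M0 SM]] _] := adjoint_spec bT.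
  have /bounded_opP[lA [N N0 AN]] := bA.
  apply/bounded_opP; split=> [a x y|] /=; first by rewrite lA lS.
  exists (M * N); first exact: mulr_ge0.
  by move=> x; apply: le_trans (SM _) _; rewrite -mulrA ler_wpM2l.
have : [set X | [/\ bounded_op X, A \o X = adjoint dot T \o A
    & range X `<=` closure (range A)]] (sharpA dot A T) by apply: xgetPex; exists X.
by move=> [bX AX _]; split=> // x; have := congr1 (fun f => f x) AX.
Qed.

End Hilbert.

(** * The A-seminorm, the A-operator norm and the A-numerical radius *)

Section AForm.
Context (R : realType) (H : completeNormedModType R[i])
  (dot : {dot H for Num.conj}) (dotH : dot_induces_norm dot).
Implicit Types (x y z : H) (c e : R) (S T : H -> H).
Local Notation nrm := (semi (re_dot dot)).
Local Notation psd := (re_dot_psd dot).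

Lemma bounded_opD S T : bounded_op S -> bounded_op T -> bounded_op (S + T).
Proof.
move=> /(bounded_opP dotH)[lS [M M0 SM]] /(bounded_opP dotH)[lT [N N0 TN]].
apply/(bounded_opP dotH); split.
  by move=> a x y; rewrite !fctE lS lT scalerDr addrACA.
exists (M + N) => [|x]; first exact: addr_ge0.
rewrite fctE mulrDl; apply: le_trans (semiD psd _ _) _; exact: lerD.
Qed.

Lemma bounded_opZ (a : R[i]) T : bounded_op T -> bounded_op (a *: T).
Proof.
move=> [lT [M TM]]; split.
  by move=> b x y; rewrite !fctE lT scalerDr !scalerA (mulrC a).
exists (complex.Re `|a| * M) => x.
have -> : (complex.Re `|a| * M)%:C = `|a| * M%:C.
  by rewrite -[in RHS](RRe_real (normr_real a)) -rmorphM.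
by rewrite fctE normrZ -mulrA; apply: ler_wpM2l.
Qed.

Lemma bounded_opN T : bounded_op T -> bounded_op (- T).
Proof. by rewrite -scaleN1r; exact: bounded_opZ. Qed.

Context (A : H -> H) (bA : bounded_op A) (pA : positive_op dot A).
Let lA : linear A := bA.1.
Let symA : forall x y, dot (A x) y = dot x (A y) := positive_op_sym lA pA.

Definition formA x y : R := complex.Re (dotA dot A x y).
Local Notation s := (normA dot A).
Local Notation B := formA.

Lemma formA_psd : psd_form formA.
Proof.
split=> [x y|x y z|c x y|x]; rewrite /formA /dotA.
- by rewrite symA dotC complexRe_conj.
- by rewrite linear_opD // linearDl /= raddfD.
- by rewrite linear_opZ // linearZl_LR /= ReM_real.
- by have := pA x; rewrite lecE => /andP[].
Qed.
Local Notation psdA := formA_psd.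

Lemma normAZ c x : s (c%:C *: x) = `|c| * s x.
Proof. exact: (semiZ psdA). Qed.

Lemma normA_sqr x : s x ^+ 2 = B x x.
Proof. exact: (semi_sqr psdA). Qed.

Lemma normA_nrm : exists2 K, 0 <= K & forall x, s x <= K * nrm x.
Proof.
have /(bounded_opP dotH)[_ [M M0 AM]] := bA.
exists (Num.sqrt M) => [|x]; first exact: sqrtr_ge0.
rewrite -[nrm x](ger0_norm (semi_ge0 _ x)) -sqrtr_sqr -sqrtrM //.
apply: ler_wsqrtr; apply: le_trans (psd_CS psd _ _) _.
by have := ler_wpM2r (semi_ge0 (re_dot dot) x) (AM x); lra.
Qed.

(** The A-seminorm is weaker than the norm, so orbits of [S] grow at most
    geometrically for it, with the norm bound of [S] as ratio. *)
Lemma symmetric_normA_bounded S : bounded_op S ->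
  (forall y z, B (S y) z = B y (S z)) -> exists2 C, 0 <= C & forall x, s (S x) <= C * s x.
Proof.
move=> /(bounded_opP dotH)[lS [M M0 SM]] symS; exists M => // x.
have [K K0 sK] := normA_nrm.
apply: (orbit_growth psdA (K := K * nrm x)) => // [|n].
  by rewrite mulr_ge0 ?semi_ge0.
apply: le_trans (sK _) _; rewrite -mulrA ler_wpM2l //.
elim: n => [|n IH]; first by rewrite expr0 mulr1.
rewrite iterS exprS; apply: le_trans (SM _) _.
by have := ler_wpM2l M0 IH; lra.
Qed.

Lemma opnormA_ge0 T : 0 <= opnormA dot A T.
Proof. by apply: sup_ge0 => _ [x _ <-]; exact: sqrtr_ge0. Qed.

(** The supremum over an empty set is 0, whence the sign condition on [C]. *)
Lemma opnormA_le T C : 0 <= C -> (forall x, s (T x) <= C * s x) ->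
  opnormA dot A T <= C.
Proof.
move=> C0 TC; rewrite /opnormA; set E := [set _ | _ in _].
have [E0|] := pselect (E !=set0); last by move=> /set0P/negP/negPn/eqP ->; rewrite sup0.
by apply: ge_sup => // _ [x [_ x1] <-]; have := TC x; rewrite x1 mulr1.
Qed.

(** The bound [C] ensures that the supremum is that of a bounded set, and
    that [T] preserves vectors of zero A-seminorm. The latter allows replacing [x]
    by its projection on the closure of the range of [A]. *)
Lemma opnormA_bound T C : linear T -> (forall x, s (T x) <= C * s x) ->
  forall x, s (T x) <= opnormA dot A T * s x.
Proof.
move=> lT TC x.
have clA := @closed_closure _ (range A).
have sV := closure_subspace dotH (range_subspace lA).
have [y Vy xy] := projection dotH x sV clA.
have ker : A (x - y) = 0 by exact: orthogonal_range_ker.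
have s0 : s (x - y) = 0 by rewrite /normA /dotA ker linear0l sqrtr0.
have sTx : s (T x) <= s (T y).
  have := semiD psdA (T y) (T (x - y)); rewrite -linear_opD // [y + _]addrC subrK.
  have := TC (x - y); rewrite s0 mulr0 /semi -/(s _) /B; rewrite /normA; lra.
have syx : s y <= s x.
  have := semiD psdA x (- (x - y)); rewrite (semiN psdA) opprB (addrC x (y - x)) subrK.
  by rewrite [semi B (x - y)]s0 addr0.
apply: le_trans sTx _; apply: le_trans (ler_wpM2l (opnormA_ge0 T) syx).
have [y0|yN0] := eqVneq (s y) 0; first by have := TC y; rewrite y0 !mulr0.
have y0 : 0 < s y by rewrite lt_neqAle eq_sym yN0 sqrtr_ge0.
rewrite -ler_pdivrMr //.
apply: ub_le_sup.
  by exists C => _ [z [_ z1] <-]; have := TC z; rewrite z1 mulr1.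
exists ((s y)^-1%:C *: y); first split.
- by have [_ _] := sV; apply.
- by rewrite normAZ ger0_norm ?invr_ge0 ?ltW // mulVf.
- by rewrite linear_opZ // normAZ ger0_norm ?invr_ge0 ?ltW // mulrC.
Qed.

Lemma numradA_ge0 T : 0 <= numradA dot A T.
Proof.
apply: sup_ge0 => _ [x _ <-]; apply: le_trans (Re_norm_ge _) => //.
Qed.

(** As for the operator norm, [C] makes the supremum meaningful and disposes of the
    vectors of zero A-seminorm, which cannot be normalised. *)
Lemma numradA_bound T C : linear T ->
  (forall x, complex.Re `|dotA dot A (T x) x| <= C * B x x) ->
  forall x, complex.Re `|dotA dot A (T x) x| <= numradA dot A T * B x x.
Proof.
move=> lT TC x; rewrite -normA_sqr.
have [x0|xN0] := eqVneq (s x) 0.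
  by have := TC x; rewrite -normA_sqr x0 expr0n /= !mulr0.
have x0 : 0 < s x by rewrite lt_neqAle eq_sym xN0 sqrtr_ge0.
rewrite -ler_pdivrMr ?exprn_gt0 //; apply: ub_le_sup.
  exists C => _ [z z1 <-]; have := TC z.
  by rewrite -normA_sqr z1 expr1n mulr1.
exists ((s x)^-1%:C *: x).
  by rewrite /= normAZ ger0_norm ?invr_ge0 ?ltW // mulVf.
rewrite linear_opZ // /dotA linear_opZ // linearZl_LR /= (linearZr_LR dot) /=.
have -> : (s x)^-1%:C * ((s x)^-1%:C^* * dot (A (T x)) x)
  = ((s x)^-1 ^+ 2)%:C * dot (A (T x)) x.
  rewrite mulrA conj_Creal ?expr2 ?rmorphM //.
  by apply/complex_realP; exists (s x)^-1.
rewrite Normc.normcM {1}/Normc.normc /= expr0n addr0 sqrtr_sqr.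
by rewrite ger0_norm ?sqr_ge0 // exprVn mulrC.
Qed.

End AForm.

(** * The Cartesian decomposition and the two inequalities *)

Section Cartesian.
Context (R : realType) (H : completeNormedModType R[i])
  (dot : {dot H for Num.conj}) (dotH : dot_induces_norm dot)
  (A : H -> H) (bA : bounded_op A) (pA : positive_op dot A)
  (T : H -> H) (T_BA : in_BA dot A T).
Implicit Types (x y z : H).
Let lA : linear A := bA.1.
Local Notation Ts := (sharpA dot A T).
Local Notation P := (ReA dot A T).
Local Notation Q := (ImA dot A T).
Local Notation B := (formA dot A).

Let bT : bounded_op T := T_BA.1.
Let bTs : bounded_op Ts := (sharpA_spec dotH bA pA T_BA).1.

Lemma bounded_ReA : bounded_op P.
Proof. by apply: bounded_opZ; apply: bounded_opD. Qed.

Lemma bounded_ImA : bounded_op Q.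
Proof. by apply: bounded_opZ; apply: bounded_opD => //; apply: bounded_opN. Qed.

Lemma half_double x : (2^-1 : R[i]) *: (x + x) = x.
Proof.
have -> : x + x = 2 *: x by rewrite -[in LHS](scale1r x) -scalerDl.
by rewrite scalerA mulVf ?scale1r // pnatr_eq0.
Qed.

Lemma cartesian x : T x = P x + 'i%C *: Q x.
Proof.
rewrite /ReA /ImA !fctE scalerA.
have -> : 'i%C * (2 * 'i%C)^-1 = 2^-1 :> R[i].
  by rewrite complexiE; field; rewrite ?neq0Ci.
by rewrite -scalerDr addrACA subrr addr0 half_double.
Qed.

Lemma cartesian_sharp x : Ts x = P x - 'i%C *: Q x.
Proof.
rewrite /ReA /ImA !fctE scalerA.
have -> : 'i%C * (2 * 'i%C)^-1 = 2^-1 :> R[i].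
  by rewrite complexiE; field; rewrite ?neq0Ci.
by rewrite -scalerBr opprB [T x + _]addrC addrACA subrr addr0 half_double.
Qed.

Lemma sharp_sum_cartesian x : Ts (T x) + T (Ts x) = 2%:C *: (P (P x) + Q (Q x)).
Proof.
have [lP _] := bounded_ReA; have [lQ _] := bounded_ImA.
rewrite (cartesian (Ts x)) (cartesian_sharp (T x)) (cartesian x) (cartesian_sharp x).
(* The definitions of the two parts would be unfolded by the rewrites below,
   and only their linearity matters from here on. *)
move: (P) (Q) lP lQ => P' Q' lP lQ.
rewrite (linear_opD _ _ lP) (linear_opD _ _ lQ) (linear_opB _ _ lP) (linear_opB _ _ lQ).
rewrite !(linear_opZ _ _ lP) !(linear_opZ _ _ lQ).
rewrite scalerBr scalerDr scalerA -expr2 sqr_i scaleN1r.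
set pp := P' (P' x); set qq := Q' (Q' x).
rewrite opprD !opprK addrACA [pp + _ + _]addrACA subrr addr0.
rewrite [- _ + _ + _]addrACA addNr add0r addrACA.
by rewrite -[in LHS](scale1r (pp + qq)) -scalerDl rmorphD.
Qed.

(** These two identities say that [T] and its reduced solution are A-adjoint to
    each other; in particular the A-real and A-imaginary parts are symmetric. *)
Lemma dotA_sharp x y : dot (A (T x)) y = dot x (A (Ts y)).
Proof.
have [_ adjT] := adjoint_spec dotH bT.
rewrite (positive_op_sym lA pA) adjT.
by rewrite (sharpA_spec dotH bA pA T_BA).2.
Qed.

Lemma dotA_sharpC x y : dot (A (Ts x)) y = dot x (A (T y)).
Proof.
by rewrite dotC -dotA_sharp -dotC.
Qed.

Lemma dotA_Re_sym x y : dot (A (P x)) y = dot x (A (P y)).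
Proof.
rewrite /ReA !fctE !(linear_opZ _ _ lA) !(linear_opD _ _ lA).
rewrite linearZl_LR linearDl (linearZr_LR dot) (linearDr dot) /=.
by rewrite dotA_sharp dotA_sharpC addrC conj_Creal ?rpredV ?realn.
Qed.

Lemma dotA_Im_sym x y : dot (A (Q x)) y = dot x (A (Q y)).
Proof.
rewrite /ImA !fctE !(linear_opZ _ _ lA) !(linear_opB _ _ lA).
rewrite linearZl_LR linearBl (linearZr_LR dot) (linearBr dot) /=.
have -> : Num.conj ((2 * 'i%C)^-1) = - (2 * 'i%C)^-1 :> R[i].
  by rewrite complexiE fmorphV rmorphM /= conjCi conj_Creal ?realn // mulrN invrN.
by rewrite dotA_sharp dotA_sharpC -opprB mulrN -mulNr.
Qed.

Lemma formA_Re_sym x y : B (P x) y = B x (P y).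
Proof. by rewrite /formA /dotA dotA_Re_sym (positive_op_sym lA pA x). Qed.

Lemma formA_Im_sym x y : B (Q x) y = B x (Q y).
Proof. by rewrite /formA /dotA dotA_Im_sym (positive_op_sym lA pA x). Qed.

Lemma dotA_cartesian x : dotA dot A (T x) x = (B (P x) x)%:C + 'i%C * (B (Q x) x)%:C.
Proof.
have real z : dot (A z) x = dot x (A z) ->
    (complex.Re (dot (A z) x))%:C = dot (A z) x.
  by move=> h; apply/RRe_real/CrealP; rewrite -dotC -h.
rewrite /formA /dotA (real _ (dotA_Re_sym x x)) (real _ (dotA_Im_sym x x)).
rewrite {1}cartesian (linear_opD (P x) _ lA) (linear_opZ _ (Q x) lA).
by rewrite (linearDl dot) /= (linearZl_LR dot).
Qed.

End Cartesian.

Theorem theorem2p2 (R : realType) (H : completeNormedModType R[i])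
    (dot : {dot H for Num.conj}) (dotH : dot_induces_norm dot)
    (A : H -> H) (A_bounded : bounded_op A) (A_pos : positive_op dot A)
    (A_neq0 : A <> 0)
    (T : H -> H) (T_BA : in_BA dot A T) :
  let Ts := sharpA dot A T in
  let ReT := ReA dot A T in
  let ImT := ImA dot A T in
  let w := numradA dot A T in
  let mid := 4^-1 * (2 * w ^+ 2
    + Num.sqrt ((opnormA dot A ReT ^+ 2 - opnormA dot A ImT ^+ 2) ^+ 2
                + 4 * opnormA dot A (ReT \o ImT) ^+ 2)) in
  4^-1 * opnormA dot A ((Ts \o T) + (T \o Ts)) <= mid /\ mid <= w ^+ 2.
Proof.
move=> Ts P Q w mid.
have psdA := formA_psd A_bounded A_pos.
have bP : bounded_op P by exact: bounded_ReA.
have bQ : bounded_op Q by exact: bounded_ImA.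
have symP : forall x y, formA dot A (P x) y = formA dot A x (P y).
  exact: formA_Re_sym.
have symQ : forall x y, formA dot A (Q x) y = formA dot A x (Q y).
  exact: formA_Im_sym.
(* Some finite bounds are needed first, to know that the suprema are those of
   bounded sets; the sharp bounds follow below. *)
have [Cp Cp0 CpP] := symmetric_normA_bounded dotH A_bounded A_pos bP symP.
have [Cq Cq0 CqQ] := symmetric_normA_bounded dotH A_bounded A_pos bQ symQ.
have formCS S C x : (forall x, normA dot A (S x) <= C * normA dot A x) ->
    `|formA dot A (S x) x| <= C * formA dot A x x.
  move=> SC; apply: le_trans (psd_CS_norm psdA _ _) _.
  rewrite -(normA_sqr A_bounded A_pos) expr2 mulrA.
  by apply: ler_wpM2r (SC x); exact: sqrtr_ge0.
have ReT x : complex.Re (dotA dot A (T x) x) = formA dot A (P x) x.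
  by rewrite dotA_cartesian //= !mul0r mul1r subrr addr0.
have ImT x : complex.Im (dotA dot A (T x) x) = formA dot A (Q x) x.
  by rewrite dotA_cartesian //= mul0r mul1r !add0r.
have w_bound : forall x, complex.Re `|dotA dot A (T x) x| <= w * formA dot A x x.
  apply: (numradA_bound A_bounded A_pos (C := Cp + Cq)); first exact: T_BA.1.1.
  move=> x; apply: le_trans (Re_norm_le _) _; rewrite ReT ImT mulrDl.
  by rewrite lerD // formCS.
have w0 : 0 <= w by exact: numradA_ge0.
have Pw : forall x, normA dot A (P x) <= w * normA dot A x.
  apply: (semi_numrad psdA) => //; first exact/linear_real_linear/bP.1.
  by move=> x; rewrite -ReT; apply: le_trans (Re_norm_ge _) (w_bound x).
have Qw : forall x, normA dot A (Q x) <= w * normA dot A x.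
  apply: (semi_numrad psdA) => //; first exact/linear_real_linear/bQ.1.
  by move=> x; rewrite -ImT; apply: le_trans (Im_norm_ge _) (w_bound x).
have lPQ : linear (P \o Q) by move=> a x y /=; rewrite bQ.1 bP.1.
pose p := opnormA dot A P; pose q := opnormA dot A Q; pose r := opnormA dot A (P \o Q).
have p0 : 0 <= p by exact: opnormA_ge0.
have q0 : 0 <= q by exact: opnormA_ge0.
have r0 : 0 <= r by exact: opnormA_ge0.
have pw : p <= w by exact: opnormA_le.
have qw : q <= w by exact: opnormA_le.
have Pp := opnormA_bound dotH A_bounded A_pos bP.1 Pw.
have Qq := opnormA_bound dotH A_bounded A_pos bQ.1 Qw.
have PQpq x : normA dot A ((P \o Q) x) <= p * q * normA dot A x.
  by apply: le_trans (Pp _) _; rewrite -mulrA ler_wpM2l.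
have PQr := opnormA_bound dotH A_bounded A_pos lPQ PQpq.
have rpq : r <= p * q by apply: opnormA_le => //; exact: mulr_ge0.
have pw2 : p ^+ 2 <= w ^+ 2 by rewrite ler_pXn2r.
have qw2 : q ^+ 2 <= w ^+ 2 by rewrite ler_pXn2r.
rewrite /mid -/p -/q -/r.
set e := Num.sqrt _.
have e0 : 0 <= e by exact: sqrtr_ge0.
split.
  suff : opnormA dot A ((Ts \o T) + (T \o Ts)) <= p ^+ 2 + q ^+ 2 + e by lra.
  apply: opnormA_le; first by rewrite !addr_ge0 ?sqr_ge0.
  move=> x; rewrite fctE /= sharp_sum_cartesian // normAZ // ger0_norm //.
  have := semi_sum_squares psdA symP symQ Pp Qq PQr x.
  rewrite -/p -/q -/r -/e /normA /semi; lra.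
suff : e <= 2 * w ^+ 2 by lra.
rewrite -(@ler_pXn2r _ 2%N) ?nnegrE ?mulr_ge0 ?sqr_ge0 // sqr_sqrtr; last first.
  by have := sqr_ge0 (p ^+ 2 - q ^+ 2); have := sqr_ge0 r; lra.
have r2 : r ^+ 2 <= (p * q) ^+ 2 by rewrite ler_pXn2r ?nnegrE ?mulr_ge0.
have sum0 : 0 <= p ^+ 2 + q ^+ 2 by rewrite addr_ge0 ?sqr_ge0.
have s2 : (p ^+ 2 + q ^+ 2) ^+ 2 <= (2 * w ^+ 2) ^+ 2.
  by rewrite ler_pXn2r ?nnegrE ?mulr_ge0 ?sqr_ge0 //; lra.
apply: le_trans s2; move: r2; rewrite exprMn; lra.
Qed.
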